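(* Let $p>3$ be prime, and let $\phi,\psi$ be (not necessarily distinct) primitive elements of the finite field $\mathbb{F}_p$. Then the $(p-2)\times(p-2)\times(p-2)$ array $D=(d_{i,j,k})$ with entries in $\{0,1\}$ given by $$d_{i,j,k} = I\big[i = \phi^j - 1 = -\psi^k\big] \quad \text{for } i,j,k\in\{1,2,\dots,p-2\}$$ (where the equations are taken in $\mathbb{F}_p$) is an order $p-2$ Costas cube for which Projection $A$ is the $W_2(p,\phi)$ Gilbert-Welch Costas array, Projection $B$ is the reflection through a vertical axis of the $W_2(p,\psi)$ Gilbert-Welch Costas array, and Projection $C$ is the $G_2(p,\phi,\psi)$ Golomb Costas array.
   Context: $I[X]$ denotes the indicator of condition $X$ ($1$ if $X$ is true, $0$ otherwise). A primitive element of $\mathbb{F}_p$ is a generator of the multiplicative group $\mathbb{F}_p^*$. The equations inside indicator functions below are equations in $\mathbb{F}_p$, the integer index $i$ being regarded as an element of $\mathbb{F}_p$ where it appears as a term of the equation. An order $n$ permutation array is an $n\times n$ array $(s_{i,j})$, with $i,j\in\{1,\dots,n\}$, of the form $s_{i,j} = I[\sigma(j)=i]$ for a permutation $\sigma$ of $\{1,\dots,n\}$. It is an order $n$ Costas array if the vectors joining pairs of $1$ entries are all distinct: whenever $(P,Q)$ and $(P',Q')$ are different ordered pairs of distinct positions, all containing $1$ entries, then $Q-P \ne Q'-P'$ in $\mathbb{Z}^2$. The projections of a three-dimensional array $(d_{i,j,k})$ are Projection $A = (a_{i,j}) = (\sum_k d_{i,j,k})$, Projection $B = (b_{i,k}) =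 (\sum_j d_{i,j,k})$, and Projection $C = (c_{j,k}) = (\sum_i d_{i,j,k})$. An order $n$ Costas cube is an $n\times n\times n$ array with entries in $\{0,1\}$ (an ''array over $\mathbb{Z}_2$'') for which Projections $A$, $B$, $C$ are each order $n$ Costas arrays. For $\alpha$ a primitive element of $\mathbb{F}_p$, the $W_2(p,\alpha)$ Gilbert-Welch Costas array is the $(p-2)\times(p-2)$ array $(s_{i,j})$ given by $s_{i,j}=I[i=\alpha^j-1]$ for $i,j\in\{1,\dots,p-2\}$ (known to be an order $p-2$ Costas array for $p>3$). For $\alpha,\beta$ primitive elements of $\mathbb{F}_p$ (not necessarily distinct), the $G_2(p,\alpha,\beta)$ Golomb Costas array is the $(p-2)\times(p-2)$ array $(s_{i,j})$ given by $s_{i,j} = I[\alpha^i+\beta^j=1]$ for $i,j\in\{1,\dots,p-2\}$ (known to be an order $p-2$ Costas array for $p>3$). Arrays are drawn with the first index increasing from left to right and the second from bottom to top, so the reflection through a vertical axis of an $n\times n$ array $(s_{i,k})$ is the array $(r_{i,k})$ with $r_{i,k}=s_{n+1-i,k}$. *)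

(* Defs.v *)
From HB Require Import structures.
From mathcomp Require Import all_boot all_order all_fingroup all_algebra all_solvable.

Set Implicit Arguments.
Unset Strict Implicit.
Unset Printing Implicit Defensive.

Import GRing.Theory.
Local Open Scope ring_scope.

(* Arrays are indexed mathematically by {1, ..., n}; the index i : 'I_n stands
   for the integer i.+1.  The first matrix index is the horizontal coordinate
   (increasing from left to right), the second the vertical one (increasing
   from bottom to top), contrary to the usual row/column reading. *)

Definition is_permutation_array (n : nat) (s : 'M[nat]_n) : Prop :=
  exists sigma : 'S_n, forall i j : 'I_n, s i j = (sigma j == i).

Definition position (n : nat) : Type := ('I_n * 'I_n)%type.

(* The vector Q - P in Z^2; the shift of indices by one cancels. *)
Definition joining_vector (n : nat) (P Q : position n) : int * int :=
  ((Q.1 : nat)%:Z - (P.1 : nat)%:Z, (Q.2 : nat)%:Z - (P.2 : nat)%:Z).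

Definition is_costas_array (n : nat) (s : 'M[nat]_n) : Prop :=
  is_permutation_array s /\
  forall P Q P' Q' : position n,
    s P.1 P.2 = 1%N -> s Q.1 Q.2 = 1%N ->
    s P'.1 P'.2 = 1%N -> s Q'.1 Q'.2 = 1%N ->
    P <> Q -> P' <> Q' -> (P, Q) <> (P', Q') ->
    joining_vector P Q <> joining_vector P' Q'.

(* Entries in {0, 1} are booleans; the projections sum them as integers, so a
   projection may a priori have entries larger than 1. *)
Definition array3 (n : nat) : Type := 'I_n -> 'I_n -> 'I_n -> bool.

Definition projectionA (n : nat) (d : array3 n) : 'M[nat]_n :=
  \matrix_(i, j) (\sum_(k < n) d i j k)%N.

Definition projectionB (n : nat) (d : array3 n) : 'M[nat]_n :=
  \matrix_(i, k) (\sum_(j < n) d i j k)%N.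

Definition projectionC (n : nat) (d : array3 n) : 'M[nat]_n :=
  \matrix_(j, k) (\sum_(i < n) d i j k)%N.

Definition is_costas_cube (n : nat) (d : array3 n) : Prop :=
  [/\ is_costas_array (projectionA d),
      is_costas_array (projectionB d)
    & is_costas_array (projectionC d)].

Definition is_primitive_element (p : nat) (a : 'F_p) : Prop :=
  exists2 u : {unit 'F_p}, generator [set: {unit 'F_p}] u & val u = a.

Definition gilbert_welch_W2 (p : nat) (alpha : 'F_p) : 'M[nat]_(p - 2) :=
  \matrix_(i, j) nat_of_bool ((i.+1)%:R == alpha ^+ j.+1 - 1).

Definition golomb_G2 (p : nat) (alpha beta : 'F_p) : 'M[nat]_(p - 2) :=
  \matrix_(i, j) nat_of_bool (alpha ^+ i.+1 + beta ^+ j.+1 == 1).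

(* rev_ord sends the integer i.+1 to n + 1 - i.+1. *)
Definition reflect_vertical_axis (n : nat) (s : 'M[nat]_n) : 'M[nat]_n :=
  \matrix_(i, k) s (rev_ord i) k.

Arguments is_primitive_element p a : clear implicits.
Arguments gilbert_welch_W2 p alpha : clear implicits.
Arguments golomb_G2 p alpha beta : clear implicits.

(* Main.v *)
Require Import Defs.
From HB Require Import structures.
From mathcomp Require Import all_boot all_order all_fingroup all_algebra all_solvable.
From mathcomp Require Import ring zify.

Set Implicit Arguments.
Unset Strict Implicit.
Unset Printing Implicit Defensive.

Import GRing.Theory.
Local Open Scope ring_scope.

(** The cube is a triple coincidence.  Adding 1 to the defining equations turns
    them into [a i = b j = c k] with [a i = i + 1], [b j = phi ^ j] and
    [c k = 1 - psi ^ k], and each of [a], [b], [c] runs through F_p minus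
    {0, 1} exactly once: this is where both the index range 1, ..., p - 2 and
    the primitivity of [phi] and [psi] come from.  Once [j] is chosen, [i] and
    [k] are therefore determined, and likewise for the other two indices; so
    summing out one index leaves the coincidence array of the other two
    sequences ([projections_of_matching]).  These three arrays are the
    Gilbert-Welch array of [phi], the reflected Gilbert-Welch array of [psi]
    (reflection exchanges the residues [i] and [- i - 1]), and the Golomb array.

    The Costas property of all three has a single source.  Write x1, x2 for the
    field elements at the two ends of a joining vector, and y1, y2 for those of
    a second one.  If the vectors are equal and the coordinates are, up to an
    affine change, a residue and a logarithm, then equality in the first
    coordinate gives x2 - x1 = y2 - y1 and equality in the second gives
    x2 / x1 = y2 / y1; together they yield (x2 - x1) (y1 - x1) = 0.  As the ends
    of a joining vector are distinct, y1 = x1 and then y2 = x2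
    ([costas_coincidence]).  For the Golomb array both coordinates are
    logarithms, of x and of 1 - x, and equality of the ratios of both again
    implies equality of the differences. *)

Definition coincidence (n : nat) (T : eqType) (u v : 'I_n -> T) : 'M[nat]_n :=
  \matrix_(i, j) nat_of_bool (u i == v j).

Lemma coincidence_permutation (n : nat) (T : eqType) (u v : 'I_n -> T) :
  injective u -> injective v -> codom u =i codom v ->
  is_permutation_array (coincidence u v).
Proof.
move=> inju injv uv.
have vu j : v j \in codom u by rewrite uv codom_f.
pose f j := iinv (vu j).
have uf j : u (f j) = v j by exact: f_iinv.
have injf : injective f by move=> j k fjk; apply: injv; rewrite -!uf fjk.
exists (perm injf) => i j; rewrite mxE permE -uf (inj_eq inju).
by rewrite eq_sym.
Qed.

Lemma sum_match (n : nat) (T : eqType) (f : 'I_n -> T) (x : T) (b : bool) :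
  injective f -> x \in codom f -> (\sum_(k < n) ((f k == x) && b) = b)%N.
Proof.
move=> injf /codomP[k0 ->]; rewrite (bigD1 k0) //= eqxx big1 ?addn0 // => k.
by rewrite (inj_eq injf) => /negPf ->.
Qed.

Lemma projections_of_matching (n : nat) (T : eqType) (a b c : 'I_n -> T)
    (d : array3 n) :
  injective a -> injective b -> injective c ->
  codom a =i codom b -> codom c =i codom b ->
  (forall i j k, d i j k = (a i == b j) && (b j == c k)) ->
  [/\ projectionA d = coincidence a b, projectionB d = coincidence a c
    & projectionC d = coincidence b c].
Proof.
move=> inja injb injc ab cb dE.
split; apply/matrixP => i j; rewrite !mxE.
- have bc : b j \in codom c by rewrite cb codom_f.
  rewrite -(sum_match (a i == b j) injc bc); apply: eq_bigr => k _.
  by rewrite dE andbC (eq_sym (b j)).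
- have ai : a i \in codom b by rewrite -ab codom_f.
  rewrite -(sum_match (a i == c j) injb ai); apply: eq_bigr => k _.
  by rewrite dE eq_sym; case: eqP => [->|].
- have bi : b i \in codom a by rewrite ab codom_f.
  rewrite -(sum_match (b i == c j) inja bi); apply: eq_bigr => k _.
  by rewrite dE.
Qed.

(** The hypothesis is the cross-multiplied form of: equal joining vectors give
    equal differences and equal ratios of the field elements at their ends. *)
Lemma costas_coincidence (n : nat) (F : idomainType) (u v : 'I_n -> F) :
  injective u -> injective v -> codom u =i codom v ->
  (forall i1 i2 i1' i2' j1 j2 j1' j2' : 'I_n,
     u i1 = v j1 -> u i2 = v j2 -> u i1' = v j1' -> u i2' = v j2' ->
     (i2 + i1' = i2' + i1)%N -> (j2 + j1' = j2' + j1)%N ->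
     u i2 + u i1' = u i2' + u i1 /\ u i2 * u i1' = u i2' * u i1) ->
  is_costas_array (coincidence u v).
Proof.
move=> inju injv uv H; split; first exact: coincidence_permutation.
have mE i j : coincidence u v i j = 1%N -> u i = v j.
  by rewrite mxE; case: eqP.
move=> [i1 j1] [i2 j2] [i1' j1'] [i2' j2'] /=.
move=> /mE e1 /mE e2 /mE e1' /mE e2' PQ _ neq [di dj]; apply: neq.
have [||sE pE] := H _ _ _ _ _ _ _ _ e1 e2 e1' e2'; [lia | lia |].
have /eqP : (u i2 - u i1) * (u i1' - u i1) = 0.
  (* After pE every term of the expansion has the factor u i1, and the cofactor
     is the difference of the two sums in sE. *)
  rewrite mulrBl !mulrBr pE; have -> : u i2' = u i2 + u i1' - u i1.
    by rewrite sE addrK.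
  by ring.
rewrite mulf_eq0 !subr_eq0 => /orP[] /eqP.
  move=> e; have ei := inju _ _ e.
  have ej : j2 = j1 by apply: injv; rewrite -e1 -e2.
  by case: PQ; rewrite ei ej.
move=> e; have ei := inju _ _ e.
have ej : j1' = j1 by apply: injv; rewrite -e1 -e1'.
have ei2 : i2' = i2 by apply: inju; apply: (addIr (u i1)); rewrite -sE e.
have ej2 : j2' = j2 by apply: injv; rewrite -e2 -e2' ei2.
by rewrite ei ej ei2 ej2.
Qed.

Lemma eq_expr_addn (R : pzSemiRingType) (x : R) (i1 i2 i1' i2' : nat) :
  (i2 + i1' = i2' + i1)%N ->
  x ^+ i2.+1 * x ^+ i1'.+1 = x ^+ i2'.+1 * x ^+ i1.+1.
Proof. by move=> e; rewrite -!exprD; congr (x ^+ _); lia. Qed.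

(** A residue coordinate preserves differences, a logarithm coordinate preserves
    ratios; the scaling [y] is there for the reflected residues, with [y = -1]. *)
Lemma costas_residue_power (n : nat) (F : idomainType) (u : 'I_n -> F)
    (x y z : F) :
  let v (j : 'I_n) := z ^+ j.+1 in
  (forall i : 'I_n, u i = x + y *+ i) ->
  injective u -> injective v -> codom u =i codom v ->
  is_costas_array (coincidence u v).
Proof.
move=> v uE inju injv uv; apply: costas_coincidence => //.
move=> i1 i2 i1' i2' j1 j2 j1' j2' e1 e2 e1' e2' ei ej; split.
  by rewrite !uE !(addrACA x (y *+ _)) -!mulrnDr ei.
by rewrite e1 e2 e1' e2'; exact: eq_expr_addn.
Qed.

Lemma costas_power_power (n : nat) (F : idomainType) (x y : F) :
  let u (i : 'I_n) := x ^+ i.+1 in let v (j : 'I_n) := 1 - y ^+ j.+1 in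
  injective u -> injective v -> codom u =i codom v ->
  is_costas_array (coincidence u v).
Proof.
move=> u v inju injv uv; apply: costas_coincidence => //.
move=> i1 i2 i1' i2' j1 j2 j1' j2' e1 e2 e1' e2' ei ej.
have pE : u i2 * u i1' = u i2' * u i1 by exact: eq_expr_addn.
(* The second coordinate is the logarithm of 1 - x, and expanding
   (1 - x2) (1 - y1) = (1 - y2) (1 - x1) leaves the sums once the products
   cancel. *)
have qE : (1 - u i2) * (1 - u i1') = (1 - u i2') * (1 - u i1).
  by rewrite e1 e2 e1' e2' /v !subKr; exact: eq_expr_addn.
split=> //; apply/eqP; rewrite -subr_eq0; apply/eqP.
have -> : u i2 + u i1' - (u i2' + u i1)
  = (1 - u i2') * (1 - u i1) - (1 - u i2) * (1 - u i1')
    + (u i2 * u i1' - u i2' * u i1) by ring.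
by rewrite qE pE !subrr addr0.
Qed.

Definition enumerates_but_0_1 (p : nat) (f : 'I_(p - 2) -> 'F_p) : Prop :=
  injective f /\ forall i, (f i != 0) && (f i != 1).

(** Surjectivity is a matter of counting: F_p minus {0, 1} has p - 2 elements. *)
Lemma codom_enumeration (p : nat) (f : 'I_(p - 2) -> 'F_p) :
  prime p -> enumerates_but_0_1 f -> codom f =i [predC pred2 0 1].
Proof.
move=> hp [injf f01]; apply/subset_cardP; last first.
  by apply/subsetP => _ /codomP[i ->]; rewrite !inE negb_or.
rewrite card_codom // card_ord.
have := cardC (pred2 (0 : 'F_p) 1).
rewrite card2 eq_sym oner_eq0 card_Fp // => /(congr1 (subn^~ 2%N)).
by rewrite addKn => ->.
Qed.

Lemma enumeration_subr (p : nat) (f : 'I_(p - 2) -> 'F_p) :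
  enumerates_but_0_1 f -> enumerates_but_0_1 (fun i => 1 - f i).
Proof.
move=> [injf f01]; split=> [i j /subrI/injf //|i].
have /andP[f0 f1] := f01 i.
by rewrite subr_eq0 eq_sym f1 /= -subr_eq0 addrAC subrr sub0r oppr_eq0.
Qed.

Lemma enumeration_residues (p : nat) : prime p ->
  @enumerates_but_0_1 p (fun i => (i.+2)%:R).
Proof.
move=> hp; have ltp (i : 'I_(p - 2)) : (i.+2 < p)%N by have := ltn_ord i; lia.
have valE (m : nat) : (m < p)%N -> ((m%:R : 'F_p) : nat) = m.
  by move=> mp; rewrite val_Fp_nat // modn_small.
split=> [i j /(congr1 (@nat_of_ord _))|i].
  by rewrite !valE // => -[] /val_inj.
have nE (m : nat) : (m < p)%N -> m != i.+2 -> ((i.+2)%:R != m%:R :> 'F_p).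
  move=> mp; apply: contraNneq => /(congr1 (@nat_of_ord _)).
  by rewrite !valE // => ->.
by rewrite (nE 0%N) ?(nE 1%N) ?prime_gt0 ?prime_gt1.
Qed.

(** A primitive element has order p - 1, and the exponents 1, ..., p - 2 stop
    just short of the full period, omitting only the value 1. *)
Lemma enumeration_primitive_powers (p : nat) (a : 'F_p) : prime p ->
  is_primitive_element p a -> enumerates_but_0_1 (fun i => a ^+ i.+1).
Proof.
move=> hp [u gu <-].
have ou : #[u]%g = p.-1.
  by rewrite orderE -(eqP gu) card_finField_unit card_Fp.
have expE (m n : nat) : (m < p.-1)%N -> (n < p.-1)%N ->
    (val u ^+ m == val u ^+ n) = (m == n).
  move=> mp np; rewrite -!FinRing.val_unitX val_eqE eq_expg_mod_order ou.
  by rewrite !modn_small.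
have ltp (i : 'I_(p - 2)) : (i.+1 < p.-1)%N by have := ltn_ord i; lia.
split=> [i j /eqP|i].
  by rewrite expE // => /eqP[] /val_inj.
rewrite -unitfE unitrX ?(valP u) //= -(expr0 (val u)) expE //.
by have := ltp i; lia.
Qed.

Theorem theorem9 (p : nat) (hp3 : (3 < p)%N) (hp : prime p) (phi psi : 'F_p)
    (hphi : is_primitive_element p phi) (hpsi : is_primitive_element p psi) :
  let D : array3 (p - 2) := fun i j k =>
    ((i.+1)%:R == phi ^+ j.+1 - 1) && (phi ^+ j.+1 - 1 == - psi ^+ k.+1) in
  [/\ is_costas_cube D,
      projectionA D = gilbert_welch_W2 p phi,
      projectionB D = reflect_vertical_axis (gilbert_welch_W2 p psi)
    & projectionC D = golomb_G2 p phi psi].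
Proof.
move=> D.
(* Adding 1 turns the equations of D into a i = b j = c k. *)
pose a (i : 'I_(p - 2)) : 'F_p := (i.+2)%:R.
pose b (j : 'I_(p - 2)) : 'F_p := phi ^+ j.+1.
pose q (k : 'I_(p - 2)) : 'F_p := psi ^+ k.+1.
pose c (k : 'I_(p - 2)) : 'F_p := 1 - q k.
pose a' (i : 'I_(p - 2)) : 'F_p := 1 - a i.
have ea : enumerates_but_0_1 a by exact: enumeration_residues.
have eb : enumerates_but_0_1 b by exact: enumeration_primitive_powers.
have eqs : enumerates_but_0_1 q by exact: enumeration_primitive_powers.
have ec : enumerates_but_0_1 c by exact: enumeration_subr.
have ea' : enumerates_but_0_1 a' by exact: enumeration_subr.
have codomE (f g : 'I_(p - 2) -> 'F_p) : enumerates_but_0_1 f ->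
    enumerates_but_0_1 g -> codom f =i codom g.
  move=> ef eg x.
  by rewrite (codom_enumeration hp ef) (codom_enumeration hp eg).
have aE (i : 'I_(p - 2)) : (i.+1)%:R = a i - 1.
  by rewrite /a [i.+2%:R]mulrSr addrK.
have revE (i : 'I_(p - 2)) : a (rev_ord i) = a' i.
  apply: (addIr (a i)); rewrite subrK /a -natrD.
  have -> : ((rev_ord i).+2 + i.+2 = p + 1)%N.
    by have := ltn_ord i; simpl; lia.
  by rewrite natrD pchar_Fp_0 // add0r.
(* Complementing to 1 trades the logarithm of 1 - x for a logarithm, while
   leaving the first coordinate a residue. *)
have acE i k : (a i == c k) = (a' i == q k).
  by rewrite /a' /c eq_sym !subr_eq addrC eq_sym [q k + _]addrC.
have [PA PB PC] : [/\ projectionA D = coincidence a b,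
    projectionB D = coincidence a c & projectionC D = coincidence b c].
  apply: projections_of_matching ea.1 eb.1 ec.1 _ _ _; [exact: codomE..|].
  move=> i j k; rewrite /D aE (inj_eq (addIr _)); congr (_ && _).
  by rewrite subr_eq [- _ + 1]addrC.
split.
- rewrite /is_costas_cube PA PB PC; split.
  + apply: (costas_residue_power (x := 2) (y := 1)) ea.1 eb.1 (codomE _ _ ea eb).
    by move=> i; rewrite -natrD.
  + have -> : coincidence a c = coincidence a' q.
      by apply/matrixP => i k; rewrite !mxE acE.
    (* a' i is the residue - 1 - i, where i counts from 0. *)
    apply: (costas_residue_power (x := -1) (y := -1)) ea'.1 eqs.1
      (codomE _ _ ea' eqs).
    by move=> i; rewrite /a' /a mulNrn !mulrS; ring.
  + exact: costas_power_power eb.1 ec.1 (codomE _ _ eb ec).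
- by rewrite PA; apply/matrixP => i j; rewrite !mxE aE (inj_eq (addIr _)).
- rewrite PB; apply/matrixP => i k.
  by rewrite !mxE acE aE (inj_eq (addIr _)) revE.
- by rewrite PC; apply/matrixP => j k; rewrite !mxE /c eq_sym subr_eq eq_sym.
Qed.
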